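(* For every graph $F$ with more than one vertex, $E[F]\ge\chi(F)$, where $\chi(F)$ is the chromatic number of $F$.
   Context: Graphs are finite, simple, undirected, loopless. For $k\ge2$, a graph satisfies $\mathrm{EA}_k$ (the $k$-extension property) if for every two disjoint vertex sets $X,Y$ with $|X\cup Y|<k$ there is a vertex $z\notin X\cup Y$ adjacent to all vertices in $X$ and non-adjacent to all vertices in $Y$; $\mathrm{EA}_1$ says the graph is non-empty. Write $F\sqsubset H$ if $H$ contains an induced copy of $F$. The extension index $E[F]$ is the minimum $k$ such that every graph $H$ satisfying $\mathrm{EA}_k$ has $F\sqsubset H$ (equivalently, the maximum $k$ such that some graph $H$ satisfies $\mathrm{EA}_{k-1}$ and $F\not\sqsubset H$). *)

(* Defs.v *)
From HB Require Import structures.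
From mathcomp Require Import all_boot.
From mathcomp Require Import boolp.

Set Implicit Arguments.
Unset Strict Implicit.
Unset Printing Implicit Defensive.

Record sgraph := SGraph {
  vertex :> finType;
  adj : rel vertex;
  adj_sym : symmetric adj;
  adj_irr : irreflexive adj
}.

(* The same formula covers k = 1, where X = Y = set0 and it says that G is     *)
(* non-empty (see EA1P). At k = 0 it is vacuous, which is why extension_index  *)
(* only ranges over k > 0.                                                     *)
Definition EA (k : nat) (G : sgraph) : Prop :=
  forall X Y : {set G}, [disjoint X & Y] -> #|X :|: Y| < k ->
  exists z : G, [/\ z \notin X :|: Y,
                    forall x, x \in X -> adj z x
                  & forall y, y \in Y -> ~~ adj z y].

Definition induced_copy (F H : sgraph) : Prop :=
  exists f : F -> H, injective f /\ forall x y, adj (f x) (f y) = adj x y.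

Definition colorable (F : sgraph) (k : nat) : bool :=
  [exists c : {ffun F -> 'I_k}, forall x, forall y, adj x y ==> (c x != c y)].

Lemma ex_colorable (F : sgraph) : exists k, colorable F k.
Proof.
exists #|F|; apply/existsP; exists [ffun x => enum_rank x].
apply/forallP => x; apply/forallP => y; apply/implyP => xy; rewrite !ffunE.
by apply/eqP => /enum_rank_inj exy; rewrite exy adj_irr in xy.
Qed.

Definition chromatic_number (F : sgraph) : nat := ex_minn (ex_colorable F).

Definition forces_induced (F : sgraph) (k : nat) : Prop :=
  forall H : sgraph, EA k H -> induced_copy F H.

Lemma EA1P (G : sgraph) : EA 1 G <-> 0 < #|G|.
Proof.
split=> [/(_ set0 set0) []|/card_gt0P[z _] X Y _].
- by rewrite disjoints_subset sub0set.
- by rewrite setU0 cards0.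
- by move=> z _; apply/card_gt0P; exists z.
rewrite ltnS leqn0 cards_eq0 setU_eq0 => /andP[/eqP-> /eqP->].
by exists z; split=> [|x|x]; rewrite ?inE.
Qed.

Lemma EA_greedy (F H : sgraph) (k : nat) (s : seq F) :
    EA k.+1 H -> uniq s -> size s <= k.+1 ->
  exists f : F -> H, {in s &, injective f} /\
    {in s &, forall x y, adj (f x) (f y) = adj x y}.
Proof.
move=> HE; elim: s => [_ _|x s IHs /= /andP[xs us] ss].
  have [] := HE set0 set0; first by rewrite disjoints_subset sub0set.
    by rewrite setU0 cards0.
  by move=> z _; exists (fun=> z); split=> ? ?; rewrite in_nil.
have [f [finj fadj]] := IHs us (ltnW ss).
pose X := f @: [set y in s | adj x y].
pose Y := f @: [set y in s | ~~ adj x y].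
have dXY : [disjoint X & Y].
  apply/pred0P => v /=; apply/negbTE/negP => /andP[/imsetP[a + ->] /imsetP[b]].
  rewrite !inE => /andP[sa xa] /andP[sb xb] /(finj _ _ sa sb) eab.
  by rewrite eab (negbTE xb) in xa.
have sXY : X :|: Y = f @: [set y in s].
  rewrite -imsetU; suff -> : [set y in s | adj x y] :|: [set y in s | ~~ adj x y]
    = [set y in s] by [].
  apply/setP => y; rewrite !inE.
  by case: (y \in s) => //=; apply: orbN.
have cXY : #|X :|: Y| < k.+1.
  rewrite sXY (leq_ltn_trans (leq_imset_card _ _)) //.
  by rewrite cardsE (leq_ltn_trans (card_size s)).
have [z [zN zX zY]] := HE X Y dXY cXY.
have zf y : y \in s -> z != f y.
  move=> sy; apply: contraNneq zN => ->; rewrite sXY.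
  by apply: imset_f; rewrite inE.
have zadj y : y \in s -> adj z (f y) = adj x y.
  move=> sy; have [xy|xy] := boolP (adj x y).
    by apply: zX; apply: imset_f; rewrite inE sy.
  by apply/negbTE/zY; apply: imset_f; rewrite inE sy.
exists (fun y => if y == x then z else f y); split=> a b; rewrite !inE;
  case: (eqVneq a x) => [->|ax] /=; case: (eqVneq b x) => [->|bx] //= sa sb.
- by move=> e; have := zf _ sb; rewrite e eqxx.
- by move=> e; have := zf _ sa; rewrite e eqxx.
- exact: finj.
- by rewrite !adj_irr.
- exact: zadj.
- by rewrite adj_sym zadj // adj_sym.
- exact: fadj.
Qed.

Lemma ex_forces_induced (F : sgraph) :
  exists k, (0 < k) && `[< forces_induced F k >].
Proof.
exists #|F|.+1; apply/asboolP => H HE.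
have [|f [finj fadj]] := EA_greedy HE (enum_uniq F); first by rewrite -cardE.
exists f; split=> x y; first by apply: finj; rewrite mem_enum.
by apply: fadj; rewrite mem_enum.
Qed.

Definition extension_index (F : sgraph) : nat := ex_minn (ex_forces_induced F).

Lemma extension_indexP (F : sgraph) :
  [/\ 0 < extension_index F, forces_induced F (extension_index F)
    & forall k, 0 < k -> forces_induced F k -> extension_index F <= k].
Proof.
rewrite /extension_index; case: ex_minnP => m /andP[m0 /asboolP Fm] mmin.
by split=> // k k0 Fk; apply: mmin; rewrite k0; apply/asboolP.
Qed.

(* Main.v *)
Require Import Defs.
From mathcomp Require Import all_boot.
From mathcomp Require Import all_algebra.

Set Implicit Arguments.
Unset Strict Implicit.
Unset Printing Implicit Defensive.

Import GRing.Theory.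

(** It suffices to exhibit, for every [k], a [k]-colorable graph [H] satisfying
    [EA k]: an induced copy of [F] in [H] with [k = E[F]] transports the coloring
    to [F].  In a [k]-partite graph, fewer than [k] vertices miss some color class
    [i], and the required vertex [z] is sought in that class.

    Rather than a random [k]-partite graph we take an explicit one.  Over a large
    finite field, vertices are polynomials of degree at most [k] whose coefficient
    of ['X^k] encodes the color; two vertices of different colors are adjacent
    when the polynomials agree somewhere on a fixed set [L] of evaluation points.
    Distinct polynomials agree on at most [k] points, so if [L] is large each
    [x] in [X] gets its own point of [L] at which it differs from all of [Y].
    Interpolating through the chosen points, and avoiding the values of [Y] on the
    rest of [L], yields [z]. *)

Lemma exists_notin (T : eqType) (s t : seq T) :
  uniq s -> size t < size s -> exists2 x, x \in s & x \notin t.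
Proof.
move=> us lt_ts; apply/hasP; apply: contraLR lt_ts => /hasPn st.
rewrite -leqNgt; apply: uniq_leq_size => // x /st.
by rewrite negbK.
Qed.

Lemma size_flatten_le (T : Type) (ss : seq (seq T)) (n : nat) :
  all (fun s => size s <= n) ss -> size (flatten ss) <= size ss * n.
Proof.
elim: ss => //= s ss IHs /andP[sn ssn].
by rewrite size_cat mulSn leq_add // IHs.
Qed.

Local Open Scope ring_scope.

(** Newton's scheme: a multiple of the product [N] over the old nodes corrects the value at the new
    node [a] and leaves the old values alone. *)
Lemma interpolation (F : fieldType) (s : seq F) (v : F -> F) :
  uniq s -> exists2 p : {poly F}, (size p <= size s)%N
                                & {in s, forall l, p.[l] = v l}.
Proof.
elim: s => [_|a s IHs /= /andP[sa us]]; first by exists 0; rewrite ?size_poly0.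
have [p sp pv] := IHs us.
pose N := \prod_(l <- s) ('X - l%:P).
have Na : N.[a] != 0 by rewrite -/(root N a) root_prod_XsubC.
exists (p + ((v a - p.[a]) / N.[a]) *: N) => [|l].
  rewrite (leq_trans (size_polyD _ _)) // geq_max (leq_trans sp) //=.
  by rewrite (leq_trans (size_scale_leq _ _)) // size_prod_XsubC.
rewrite !hornerE inE => /predU1P[->|ls]; first by rewrite divfK // subrKC.
have /eqP-> : root N l by rewrite root_prod_XsubC.
by rewrite mulr0 addr0 pv.
Qed.

(** Since [N] vanishes on [s], the scalar [c] in [p + c *: N] is free. At a point outside [s] each
    forbidden value rules out a single [c], so at most [size L * n] scalars are lost. *)
Lemma interpolation_avoid (F : finFieldType) (s L : seq F) (v : F -> F)
    (A : F -> seq F) (n : nat) :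
  uniq s -> (forall l, size (A l) <= n)%N -> (size L * n < #|F|)%N ->
  exists p : {poly F}, [/\ (size p <= (size s).+1)%N,
    {in s, forall l, p.[l] = v l} &
    forall l, l \in L -> l \notin s -> p.[l] \notin A l].
Proof.
move=> us An Ln; have [p sp pv] := interpolation v us.
pose N := \prod_(l <- s) ('X - l%:P).
pose B := flatten [seq [seq (w - p.[l]) / N.[l] | w <- A l] | l <- L].
have [|c _ cB] := @exists_notin _ (enum F) B (enum_uniq F).
  rewrite -cardE (leq_ltn_trans _ Ln) // (leq_trans (@size_flatten_le _ _ n _)) //.
    by rewrite all_map; apply/allP => l _ /=; rewrite size_map.
  by rewrite size_map.
exists (p + c *: N); split=> [|l ls|l lL ls].
- rewrite (leq_trans (size_polyD _ _)) // geq_max leqW //=.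
  by rewrite (leq_trans (size_scale_leq _ _)) // size_prod_XsubC.
- have /eqP Nl : root N l by rewrite root_prod_XsubC.
  by rewrite !hornerE Nl mulr0 addr0 pv.
have Nl : N.[l] != 0 by rewrite -/(root N l) root_prod_XsubC.
apply: contra cB => pA; apply/flatten_mapP; exists l => //.
by apply/mapP; exists (p + c *: N).[l]; rewrite // !hornerE addrC addKr mulfK.
Qed.

Lemma size_roots_le (F : fieldType) (p : {poly F}) (L : seq F) (n : nat) :
  uniq L -> p != 0 -> (size p <= n.+1)%N -> (size [seq l <- L | root p l] <= n)%N.
Proof.
move=> uL p0 sp; rewrite -ltnS (leq_trans _ sp) // max_poly_roots //.
  by apply/allP => l; rewrite mem_filter => /andP[].
exact: filter_uniq.
Qed.

(** Greedy choice: a new [x] must avoid the points already taken, at most one per earlier element,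
    and at most [d] points of agreement with each [y]. Taking a fresh point lets [v] be extended
    without conflict. *)
Lemma separating_points (F : fieldType) (T : eqType) (P : T -> {poly F})
    (L : seq F) (d : nat) (xs ys : seq T) :
  injective P -> (forall x, size (P x) <= d.+1)%N -> uniq L ->
  (size xs + size ys * d <= size L)%N -> {in xs, forall x, x \notin ys} ->
  exists (s : seq F) (v : F -> F),
    [/\ uniq s, (size s <= size xs)%N, {subset s <= L},
        {in xs, forall x, exists2 l, l \in s & v l = (P x).[l]} &
        {in s, forall l, {in ys, forall y, v l != (P y).[l]}}].
Proof.
move=> Pinj Pd uL; elim: xs => [_ _|x xs IHs /= le_L dis].
  by exists [::], (fun=> 0).
have [] := IHs (ltnW le_L).
  by move=> z zxs; apply: dis; rewrite inE zxs orbT.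
move=> s [v [us ss sL xsv ysv]].
pose bad := flatten [seq [seq l <- L | root (P x - P y) l] | y <- ys].
have xNys : x \notin ys by apply: dis; rewrite mem_head.
have [|l lL] := @exists_notin _ L (s ++ bad) uL.
  rewrite size_cat (leq_trans _ le_L) // addSn ltnS leq_add //.
  rewrite (leq_trans (@size_flatten_le _ _ d _)) ?size_map //.
  rewrite all_map; apply/allP => y yys /=; apply: size_roots_le => //.
    by rewrite subr_eq0; apply: contraNneq xNys => /Pinj->.
  by rewrite (leq_trans (size_polyD _ _)) // size_polyN geq_max !Pd.
rewrite mem_cat negb_or => /andP[lNs lNbad].
have vE z : z \in s -> z == l = false.
  by move=> zs; apply: contraNF lNs => /eqP <-.
exists (l :: s), (fun z => if z == l then (P x).[l] else v z); split.
- by rewrite /= lNs.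
- by rewrite /= ltnS.
- by move=> z; rewrite inE => /predU1P[->|/sL].
- move=> z; rewrite inE => /predU1P[->|/xsv[l' l's vl']].
    by exists l; rewrite ?mem_head ?eqxx.
  by exists l'; rewrite ?vE // inE l's orbT.
move=> z; rewrite inE => /predU1P[->|zs] y yys; last by rewrite vE ?ysv.
rewrite eqxx; apply: contra lNbad => /eqP Pxy; apply/flatten_mapP; exists y => //.
by rewrite mem_filter lL rootE !hornerE Pxy subrr eqxx.
Qed.

Section PolynomialGraph.

Variables (F : finFieldType) (k : nat) (L : seq F).

Definition color_tag (i : 'I_k) : F := nth 0 (enum F) i.

Definition vpoly (u : 'I_k * 'rV[F]_k) : {poly F} :=
  rVpoly u.2 + color_tag u.1 *: 'X^k.

Definition agree_rel : rel ('I_k * 'rV[F]_k) :=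
  fun u v => (u.1 != v.1) && has (fun l => (vpoly u).[l] == (vpoly v).[l]) L.

Lemma agree_rel_sym : symmetric agree_rel.
Proof.
move=> u v; rewrite /agree_rel eq_sym; congr (_ && _).
by apply: eq_has => l; rewrite eq_sym.
Qed.

Lemma agree_rel_irr : irreflexive agree_rel.
Proof. by move=> u; rewrite /agree_rel eqxx. Qed.

Definition agree_graph : sgraph := SGraph agree_rel_sym agree_rel_irr.

Lemma agree_graph_colorable : colorable agree_graph k.
Proof.
apply/existsP; exists [ffun u : agree_graph => u.1].
apply/forallP => u; apply/forallP => v; apply/implyP.
by rewrite !ffunE => /andP[].
Qed.

Lemma size_vpoly u : (size (vpoly u) <= k.+1)%N.
Proof.
rewrite (leq_trans (size_polyD _ _)) // geq_max leqW ?size_poly //=.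
by rewrite (leq_trans (size_scale_leq _ _)) // size_polyXn.
Qed.

(** The row vector only reaches coefficients below [k], so the coefficient of ['X^k] is the tag; the
    bound on [k] keeps tags of different colors distinct. *)
Lemma vpoly_inj : (k <= #|F|)%N -> injective vpoly.
Proof.
move=> kF [i v] [j w] /= E; rewrite /vpoly /= in E.
have ij : i = j.
  have /eqP := congr1 (fun p : {poly F} => p`_k) E.
  rewrite !coefD !coefZ !coefXn eqxx !mulr1.
  rewrite !(@nth_default _ 0 (rVpoly _)) ?size_poly // !add0r.
  rewrite nth_uniq ?enum_uniq // -?cardE ?(leq_trans (ltn_ord _)) //.
  by move=> /eqP/val_inj.
by move: E; rewrite ij => /addIr/(can_inj rVpolyK)->.
Qed.

Lemma agree_graph_EA : uniq L -> (k + k * k <= size L)%N ->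
  (size L * k < #|F|)%N -> (k <= #|F|)%N -> EA k agree_graph.
Proof.
move=> uL leL LF kF X Y dXY cXY.
have [i iN] : exists i : 'I_k, i \notin [set u.1 | u in X :|: Y].
  apply/existsP; apply: contraLR cXY; rewrite negb_exists -leqNgt => /forallP h.
  rewrite (leq_trans _ (leq_imset_card (fun u : agree_graph => u.1) _)) //.
  rewrite -[leqLHS]card_ord subset_leq_card //; apply/subsetP => i _.
  by have := h i; rewrite negbK.
have cX : (size (enum X) < k)%N.
  by rewrite -cardE (leq_ltn_trans _ cXY) // subset_leq_card ?subsetUl.
have cY : (size (enum Y) < k)%N.
  by rewrite -cardE (leq_ltn_trans _ cXY) // subset_leq_card ?subsetUr.
have [||s [v [us ss sL Xv Yv]]] :=
    @separating_points F agree_graph vpoly L k (enum X) (enum Y)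
      (vpoly_inj kF) size_vpoly uL.
- by rewrite (leq_trans _ leL) // leq_add ?leq_mul // ltnW.
- by move=> x; rewrite !mem_enum => xX; rewrite (disjointFr dXY).
(* The leading term of [z] is forced by its color [i], so its contribution [t] is subtracted from
   all prescribed and forbidden values. *)
pose t l := (color_tag i *: 'X^k : {poly F}).[l].
have [|p [sp pv pA]] := @interpolation_avoid F s L (fun l => v l - t l)
    (fun l => [seq (vpoly y).[l] - t l | y <- enum Y]) k us _ LF.
  by move=> l; rewrite size_map ltnW.
(* The strict bound [size s < k] gives [size p <= k], so [poly_rV] does not truncate [p]. *)
have ppoly l : (vpoly (i, poly_rV p)).[l] = p.[l] + t l.
  rewrite /vpoly /= poly_rV_K ?hornerD // (leq_trans sp) //.
  by rewrite (leq_ltn_trans ss).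
have iNu u : u \in X :|: Y -> i != u.1.
  by move=> uXY; apply: contraNneq iN => ->; apply: imset_f.
exists (i, poly_rV p); split=> [|x xX|y yY].
- by apply: contra iN => zXY; apply/imsetP; exists (i, poly_rV p).
- rewrite /adj /= /agree_rel iNu ?inE ?xX //=.
  have [|l ls vl] := Xv x; first by rewrite mem_enum.
  by apply/hasP; exists l; rewrite ?sL // ppoly pv // subrK vl.
rewrite /adj /= /agree_rel negb_and; apply/orP; right; apply/hasPn => l lL.
have yY' : y \in enum Y by rewrite mem_enum.
(* On [s] the values [v] already differ from those of [y]; elsewhere on [L] the choice of [p] avoids
   them. *)
rewrite ppoly; have [ls|ls] := boolP (l \in s).
  by rewrite pv // subrK Yv.
apply: contra (pA l lL ls) => /eqP E; apply/mapP; exists y => //.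
by rewrite -E addrK.
Qed.

End PolynomialGraph.

Lemma colorable_EA_exists (k : nat) : exists2 H : sgraph, EA k H & colorable H k.
Proof.
pose n := (k + k * k)%N.
(* This prime leaves room both for [n] evaluation points in the field and for the [n * k] excluded
   scalars. *)
have [p lt_p pr_p] := prime_above (n + n * k).
have cF : #|'F_p| = p by rewrite card_Fp.
have nF : (n <= #|'F_p|)%N by rewrite cF ltnW // (leq_ltn_trans _ lt_p) ?leq_addr.
exists (@agree_graph 'F_p k (take n (enum 'F_p))); last exact: agree_graph_colorable.
have szL : size (take n (enum 'F_p)) = n by rewrite size_takel // -cardE.
apply: agree_graph_EA; rewrite ?szL //.
- by rewrite take_uniq ?enum_uniq.
- by rewrite cF (leq_ltn_trans _ lt_p) ?leq_addl.
- by rewrite (leq_trans _ nF) ?leq_addr.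
Qed.

Local Close Scope ring_scope.

Lemma induced_copy_colorable (F H : sgraph) (k : nat) :
  induced_copy F H -> colorable H k -> colorable F k.
Proof.
move=> [f [_ fadj]] /existsP[c /forallP cP].
apply/existsP; exists [ffun x => c (f x)].
apply/forallP => x; apply/forallP => y; rewrite !ffunE -fadj.
by have /forallP := cP (f x).
Qed.

Theorem theorem3p3 (F : sgraph) (hF : 1 < #|F|) :
  chromatic_number F <= extension_index F.
Proof.
have [_ forcesF _] := extension_indexP F.
have [H HEA Hcol] := colorable_EA_exists (extension_index F).
rewrite /chromatic_number; case: ex_minnP => m _; apply.
exact: induced_copy_colorable (forcesF H HEA) Hcol.
Qed.
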